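(* Let $P \subset \mathbb{R}^n$ be a full-dimensional (i.e. $n$-dimensional) generic polytope with $v$ vertices. Then the psd rank of $P$ is at least $(nv)^{1/4}$.
   Context: A polytope $P \subset \mathbb{R}^n$ with $v$ vertices is called generic if the $nv$ coordinates of its vertices are algebraically independent over $\mathbb{Q}$, i.e. they do not satisfy any non-trivial polynomial equation with rational coefficients. Let $\mathcal{S}^k$ be the space of real symmetric $k\times k$ matrices and $\mathcal{S}_+^k$ the cone of positive semidefinite matrices in it. The psd rank of a polytope $P \subset \mathbb{R}^n$ is the smallest positive integer $k$ such that $P$ is the image under a linear map of an affine slice of $\mathcal{S}_+^k$, i.e. of a set $\mathcal{A} \cap \mathcal{S}_+^k$ with $\mathcal{A}$ an affine subspace of $\mathcal{S}^k$. For a full-dimensional polytope $P$ with vertices $p_1,\dots,p_v$ and facet inequalities $d_j - c_j^T x \ge 0$ ($j=1,\dots,f$), it is known that this number equals the psd rank of the slack matrix of $P$, the $v\times f$ matrix with entries $d_j - c_j^T p_i$; here the psd rank of a nonnegative $p\times q$ matrix $M$ is the smallest $k$ such that there are $A_1,\dots,A_p,B_1,\dots,B_q\in\mathcal{S}_+^k$ with $M_{ij}=\mathrm{Trace}(A_iB_j)$ for all $i,j$. *)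

(* Defs.v *)
From HB Require Import structures.
From mathcomp Require Import all_boot all_order all_algebra.
(* The notations of mpoly clash with those of mathcomp-analysis. *)
From mathcomp Require Import -(notations) mpoly.
From mathcomp Require Import boolp classical_sets functions cardinality reals exp.

Set Implicit Arguments.
Unset Strict Implicit.
Unset Printing Implicit Defensive.

Import Order.TTheory GRing.Theory Num.Theory.

Local Open Scope classical_set_scope.
Local Open Scope ring_scope.

Definition conv_hull (R : realType) (n m : nat) (p : 'I_m -> 'rV[R]_n) :
    set 'rV[R]_n :=
  [set x | exists a : 'I_m -> R, [/\ forall i, 0 <= a i, \sum_i a i = 1
                                   & x = \sum_i a i *: p i]].

Definition polytope (R : realType) (n : nat) (P : set 'rV[R]_n) : Prop :=
  exists (m : nat) (p : 'I_m -> 'rV[R]_n), P = conv_hull p.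

(* The vertices of a polytope are its extreme points. *)
Definition vertices (R : realType) (n : nat) (P : set 'rV[R]_n) :
    set 'rV[R]_n :=
  [set x | P x /\ forall (y z : 'rV[R]_n) (t : R), P y -> P z -> 0 < t < 1 ->
             x = (1 - t) *: y + t *: z -> y = x /\ z = x].

Definition affine_subspace (R : realType) (V : vectType R) (x0 : V)
    (U : {vspace V}) : set V :=
  [set x | x - x0 \in U].

Definition affine_hull (R : realType) (n : nat) (P : set 'rV[R]_n) :
    set 'rV[R]_n :=
  [set x | exists (m : nat) (p : 'I_m -> 'rV[R]_n) (a : 'I_m -> R),
             [/\ forall i, P (p i), \sum_i a i = 1 & x = \sum_i a i *: p i]].

Definition has_dim (R : realType) (n : nat) (P : set 'rV[R]_n) (d : nat) :
    Prop :=
  exists (x0 : 'rV[R]_n) (U : {vspace 'rV[R]_n}),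
    affine_hull P = affine_subspace x0 U /\ \dim U = d.

Definition alg_independent (R : realType) (m : nat) (x : 'I_m -> R) : Prop :=
  forall q : mpoly m rat,
    meval x (map_mpoly (@ratr R) q) = 0 -> q = 0.

(* The rows of V list the vertices of P without repetition; mxvec V is then the
   family of all their coordinates. *)
Definition generic (R : realType) (n : nat) (P : set 'rV[R]_n) : Prop :=
  exists (v : nat) (V : 'M[R]_(v, n)),
    [/\ injective (fun i => row i V), range (fun i => row i V) = vertices P
      & alg_independent (fun k => mxvec V 0 k)].

Definition sym_mx (R : realType) (k : nat) : set 'M[R]_k :=
  [set A | A^T = A].

Definition psd_mx (R : realType) (k : nat) : set 'M[R]_k :=
  [set A | A^T = A /\ forall u : 'rV[R]_k, 0 <= (u *m A *m u^T) 0 0].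

(* The linear map is defined on all k x k matrices: a linear map on the
   subspace of symmetric matrices always extends. *)
Definition psd_lift (R : realType) (n : nat) (P : set 'rV[R]_n) (k : nat) :
    Prop :=
  exists (A0 : 'M[R]_k) (U : {vspace 'M[R]_k})
         (f : {linear 'M[R]_k -> 'rV[R]_n}),
    affine_subspace A0 U `<=` @sym_mx R k /\
    P = f @` (affine_subspace A0 U `&` @psd_mx R k).

Definition is_psd_rank (R : realType) (n : nat) (P : set 'rV[R]_n) (k : nat) :
    Prop :=
  [/\ (0 < k)%N, psd_lift P k
    & forall j : nat, (0 < j)%N -> psd_lift P j -> (k <= j)%N].

(* The default 0 is never taken on a nonempty polytope, see psd_rankP. *)
Definition psd_rank (R : realType) (n : nat) (P : set 'rV[R]_n) : nat :=
  xget 0%N [set k | is_psd_rank P k].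

Lemma polytope_psd_lift (R : realType) (n m : nat) (p : 'I_m -> 'rV[R]_n) :
  (0 < m)%N -> psd_lift (conv_hull p) m.
Proof.
move=> m0.
pose g (B : 'M[R]_m) : 'M[R]_m * R^o :=
  (\matrix_(i, j) (B i j *+ (i != j)), \tr B).
have lg : linear g.
  move=> a B C; rewrite /g; congr pair; last by rewrite linearP.
  by apply/matrixP => i j; rewrite !mxE; case: (i != j); rewrite ?mulr0n ?mulr0 ?addr0.
pose gl := GRing.isLinear.Build _ _ _ _ g lg.
pose G : {linear 'M[R]_m -> ('M[R]_m * R^o)%type} := HB.pack g gl.
pose f (B : 'M[R]_m) : 'rV[R]_n := \sum_i B i i *: p i.
have lf : linear f.
  move=> a B C; rewrite /f scaler_sumr -big_split; apply: eq_bigr => i _ /=.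
  by rewrite !mxE scalerDl scalerA.
pose fl := GRing.isLinear.Build _ _ _ _ f lf.
pose F : {linear 'M[R]_m -> 'rV[R]_n} := HB.pack f fl.
pose i0 := Ordinal m0.
pose A0 : 'M[R]_m := delta_mx i0 i0.
exists A0, (lker (linfun G)), F.
have inA B : affine_subspace A0 (lker (linfun G)) B <->
    (forall i j, i != j -> B i j = 0) /\ \sum_i B i i = 1.
  rewrite /affine_subspace /= memv_ker (lfunE G) /= /g.
  have trA0 : \tr A0 = 1.
    rewrite /mxtrace (bigD1 i0) //= mxE !eqxx big1 ?addr0 // => i /negPf ii0.
    by rewrite mxE ii0.
  rewrite linearB /= trA0; split.
  - move=> /eqP[/matrixP E /eqP]; rewrite subr_eq0 => /eqP tB; split => // i j ij.
    have := E i j; rewrite !mxE ij mulr1n => /eqP; rewrite subr_eq0 => /eqP ->.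
    by case: eqP => // ii0; case: eqP => // ji0; rewrite ii0 ji0 eqxx in ij.
  - move=> [od tB]; apply/eqP; congr pair; last by rewrite /mxtrace tB subrr.
    apply/matrixP => i j; rewrite !mxE.
    have [|ij] := eqVneq i j; first by rewrite mulr0n.
    rewrite od // mulr1n sub0r.
    case: eqP => [ii0|_]; last by rewrite oppr0.
    by case: eqP => [ji0|_]; [rewrite ii0 ji0 eqxx in ij | rewrite oppr0].
split.
  move=> B /inA[od _]; apply/matrixP => i j; rewrite mxE.
  by have [->//|ij] := eqVneq i j; rewrite !od // eq_sym.
rewrite predeqE => x; split.
- move=> [a [a0 a1 ->]]; exists (diag_mx (\row_i a i)); last first.
    by rewrite /= /f; apply: eq_bigr => i _; rewrite !mxE eqxx.
  split.
    apply/inA; split; first by move=> i j /negPf ij; rewrite !mxE ij.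
    by rewrite -a1; apply: eq_bigr => i _; rewrite !mxE eqxx.
  split; first by rewrite tr_diag_mx.
  move=> u; rewrite mxE; apply: sumr_ge0 => i _.
  rewrite mul_mx_diag !mxE mulrAC.
  by apply: mulr_ge0; rewrite // -expr2 sqr_ge0.
- move=> [B [/inA[od tB] [_ pB]] <-]; exists (fun i => B i i); split => // i.
  have := pB (delta_mx 0 i).
  by rewrite -rowE trmx_delta -colE !mxE.
Qed.

Lemma psd_rankP (R : realType) (n : nat) (P : set 'rV[R]_n) :
  polytope P -> P !=set0 -> is_psd_rank P (psd_rank P).
Proof.
move=> [m [p ->]] [x [a [_ a1 _]]]; rewrite /psd_rank; apply: xgetPex.
have m0 : (0 < m)%N.
  case: m p a a1 => // p a; rewrite big_ord0 => /eqP.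
  by rewrite eq_sym oner_eq0.
have ex : exists k, (0 < k)%N && `[< psd_lift (conv_hull p) k >].
  by exists m; rewrite m0; apply/asboolP; exact: polytope_psd_lift.
case: (ex_minnP ex) => k /andP[k0 /asboolP lk] mink; exists k; split => // j j0 lj.
by apply: mink; rewrite j0; apply/asboolP.
Qed.

(* Main.v *)
(* Let k be the psd rank, and let P be the image under a linear map f of the
   slice (A0 + U) of the k x k psd cone, with d = dim U and N = k (k + 1) / 2.
   The lift is described by the entries of A0, of a basis of U and of their
   images under f, that is by (d + 1) (N + n) <= N (2 N - 1) <= k^4 real
   parameters. If n v > k^4, linear algebra on the derivations of R dual to the
   algebraically independent vertex coordinates gives a derivation D of R that
   kills all the parameters but not all coordinates of some vertex p = f X.
   Since k is minimal, the slice contains a positive definite matrix, and this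
   makes it possible to bend the line X + s D X, which is tangent to the psd cone,
   into a curve that stays in the slice. Its image under f runs in P through the
   vertex p on both sides with velocity D p, which forces D p = 0. *)

Require Import Defs.
From HB Require Import structures.
From mathcomp Require Import all_boot all_order all_algebra.
From mathcomp Require Import -(notations) mpoly.
From mathcomp Require Import ring lra zify.
From mathcomp Require Import boolp classical_sets functions cardinality reals exp.

Set Implicit Arguments.
Unset Strict Implicit.
Unset Printing Implicit Defensive.

Import Order.TTheory GRing.Theory Num.Theory.

Local Open Scope classical_set_scope.
Local Open Scope ring_scope.

(** * Extension of derivations from a subring to the whole field *)

Section Derivations.
Variable F : numFieldType.
Implicit Types (G : set (F * F)) (z w : F).

Definition derivation (D : F -> F) : Prop :=
  (forall x y, D (x - y) = D x - D y) /\
  (forall x y, D (x * y) = D x * y + x * D y).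

(* The graph of a derivation defined on a subring of F, with values in F. *)
Definition derivation_graph G : Prop :=
  [/\ G (1, 0),
      forall a b a' b', G (a, a') -> G (b, b') -> G (a - b, a' - b'),
      forall a b a' b', G (a, a') -> G (b, b') -> G (a * b, a' * b + a * b')
    & forall w, G (0, w) -> w = 0].

(** [q] is [p] with the derivation applied to each coefficient, expressed as a relation because [G]
    is only a graph. *)
Definition polyG G (p q : {poly F}) := forall i, G (p`_i, q`_i).

(* The value at p.[z] of a derivation that sends z to w and the coefficients
   of p to those of q. *)
Definition jet z w (p q : {poly F}) : F := q.[z] + p^`().[z] * w.

Lemma jetB z w p q p' q' :
  jet z w (p - p') (q - q') = jet z w p q - jet z w p' q'.
Proof. by rewrite /jet derivB !hornerE; ring. Qed.

Lemma jetM z w p q p' q' : jet z w (p * p') (q * p' + p * q') =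
  jet z w p q * p'.[z] + p.[z] * jet z w p' q'.
Proof. by rewrite /jet derivM !hornerE; ring. Qed.

Lemma jet0 z w : jet z w 0 0 = 0.
Proof. by rewrite /jet deriv0 !hornerE ?mul0r. Qed.

(** The extension to the ring generated by [z] over the domain of [G], sending [z] to [w]. For an
    arbitrary [w] it may fail to be single-valued. *)
Definition adjoin_graph G z w : set (F * F) :=
  [set c | exists p q, polyG G p q /\ c = (p.[z], jet z w p q)].

Section Graph.
Variable G : set (F * F).
Hypothesis hG : derivation_graph G.

Let G1 : G (1, 0). Proof. by case: hG. Qed.

Let GB a b a' b' : G (a, a') -> G (b, b') -> G (a - b, a' - b').
Proof. by case: hG => _ + _ _; exact. Qed.

Let GM a b a' b' : G (a, a') -> G (b, b') -> G (a * b, a' * b + a * b').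
Proof. by case: hG => _ _ + _; exact. Qed.

Let G0 : G (0, 0).
Proof. by have := GB G1 G1; rewrite !subrr. Qed.

Let GN a a' : G (a, a') -> G (- a, - a').
Proof. by move=> h; have := GB G0 h; rewrite !sub0r. Qed.

Let GD a b a' b' : G (a, a') -> G (b, b') -> G (a + b, a' + b').
Proof. by move=> ha /GN hb; have := GB ha hb; rewrite !opprK. Qed.

Let GMn n a a' : G (a, a') -> G (a *+ n, a' *+ n).
Proof. by move=> h; elim: n => // n IH; rewrite !mulrS; exact: GD. Qed.

Let G_sum (I : Type) (r : seq I) (P : pred I) (f g : I -> F) :
  (forall i, G (f i, g i)) -> G (\sum_(i <- r | P i) f i, \sum_(i <- r | P i) g i).
Proof.
move=> h; apply: (big_ind2 (fun x y => G (x, y))) => // a a' b b'; exact: GD.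
Qed.

Let polyGB p q p' q' : polyG G p q -> polyG G p' q' -> polyG G (p - p') (q - q').
Proof. by move=> h h' i; rewrite !coefB; exact: GB. Qed.

Let polyGM p q p' q' : polyG G p q -> polyG G p' q' ->
  polyG G (p * p') (q * p' + p * q').
Proof.
move=> h h' i; rewrite coefD !coefM -big_split /=.
by apply: G_sum => j; exact: GM.
Qed.

Let polyGC a a' : G (a, a') -> polyG G a%:P a'%:P.
Proof. by move=> h i; rewrite !coefC; case: eqP. Qed.

Let polyGXn n : polyG G 'X^n 0.
Proof. by move=> i; rewrite coefXn coef0; case: eqP. Qed.

Lemma graph_sub_adjoin z w : G `<=` adjoin_graph G z w.
Proof.
move=> [a a'] h; exists a%:P, a'%:P; split; first exact: polyGC.
by rewrite /jet derivC !hornerE ?mul0r ?addr0.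
Qed.

Lemma mem_adjoin_graph z w : adjoin_graph G z w (z, w).
Proof.
exists 'X, 0; split; first exact: (polyGXn 1).
by rewrite /jet derivX !hornerE ?mul1r ?add0r.
Qed.

(** If [z] is transcendental over the domain of [G], any [w] will do. If it is algebraic, a
    polynomial [p] of least degree vanishing at [z] forces [w], and [p] has a nonzero derivative at
    [z] in characteristic 0. *)
Lemma adjoin_derivation_graph z : exists w, derivation_graph (adjoin_graph G z w).
Proof.
(* Only single-valuedness at 0 is at stake; the closure properties hold for every [w]. *)
suff [w hw] : exists w, forall p q, polyG G p q -> p.[z] = 0 ->
    jet z w p q = 0.
  exists w; split.
  - exact/graph_sub_adjoin.
  - move=> a b a' b' [p [q [h [-> ->]]]] [p' [q' [h' [-> ->]]]].
    exists (p - p'), (q - q'); split; first exact: polyGB.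
    by rewrite jetB !hornerE.
  - move=> a b a' b' [p [q [h [-> ->]]]] [p' [q' [h' [-> ->]]]].
    exists (p * p'), (q * p' + p * q'); split; first exact: polyGM.
    by rewrite jetM !hornerE.
  - by move=> v [p [q [h [e ->]]]]; apply: hw.
have G0P p q : polyG G p q -> p = 0 -> q = 0.
  move=> + p0; rewrite {}p0 => h; apply/polyP => i; rewrite coef0.
  by case: hG => _ _ _; apply; have := h i; rewrite coef0.
have [ex|nex] := pselect (exists n p q,
    [/\ polyG G p q, p.[z] = 0, p != 0 & size p = n]); last first.
  exists 0 => p q h pz; have [p0|pn0] := eqVneq p 0.
    by rewrite (G0P _ _ h p0) p0 jet0.
  by case: nex; exists (size p), p, q.
have exb : exists n, `[< exists p q,
    [/\ polyG G p q, p.[z] = 0, p != 0 & size p = n] >].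
  by case: ex => n h; exists n; exact/asboolP.
case: (ex_minnP exb) => n /asboolP[p [q [hpq pz pn0 sp]]] minn {ex exb}.
have minp p' q' : polyG G p' q' -> p'.[z] = 0 -> (size p' < n)%N -> p' = 0.
  move=> h p'z; apply: contraTeq => p'n0; rewrite -leqNgt.
  by apply: minn; apply/asboolP; exists p', q'.
have n1 : (1 < n)%N.
  rewrite -sp ltnNge; apply/negP => /size1_polyC pC.
  by move: pz pn0; rewrite pC hornerC polyC_eq0 => ->; rewrite eqxx.
(* The derivative of [p] has smaller degree and coefficients in the domain of [G], so if it vanished
   at [z] it would be 0 by minimality. *)
have dpz : p^`().[z] != 0.
  apply/eqP => dpz; have dp0 : p^`() = 0.
    apply: (minp _ q^`()) => //; last by rewrite -sp lt_size_deriv.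
    by move=> i; rewrite !coef_deriv; exact: GMn.
  have /eqP : p^`()`_n.-2 = 0 by rewrite dp0 coef0.
  rewrite coef_deriv -mulr_natr mulf_eq0 pnatr_eq0 orbF.
  case: (n) n1 sp => [|[|m]] //= _ sp.
  by rewrite -[m.+1]/m.+2.-1 -sp -lead_coefE lead_coef_eq0 (negPf pn0).
pose w := - q.[z] / p^`().[z]; exists w.
have ep : jet z w p q = 0.
  by rewrite /jet /w mulrCA mulfV // mulr1 subrr.
move=> p' q'; have [m] := ubnP (size p'); elim: m p' q' => // m IH p' q' sp' h' p'z.
have [slt|sge] := ltnP (size p') n.
  have p'0 := minp _ _ h' p'z slt.
  by rewrite (G0P _ _ h' p'0) p'0 jet0.
(* One step of pseudo-division of [p'] by [p]: the domain of [G] is only a ring, so the leading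
   terms are cancelled by cross multiplication. *)
pose d := (size p' - size p)%N; pose a := lead_coef p; pose b := lead_coef p'.
pose a' := q`_(size p).-1; pose b' := q'`_(size p').-1.
have Ga : G (a, a') := hpq _.
have Gb : G (b, b') := h' _.
have bX : polyG G (b%:P * 'X^d) (b'%:P * 'X^d).
  by have := polyGM (polyGC Gb) (polyGXn d); rewrite mulr0 addr0.
pose p1 := a%:P * p' - b%:P * 'X^d * p.
pose q1 := (a'%:P * p' + a%:P * q') - (b'%:P * 'X^d * p + b%:P * 'X^d * q).
have h1 : polyG G p1 q1 by apply: polyGB; apply: polyGM => //; exact: polyGC.
have an0 : a != 0 by rewrite lead_coef_eq0.
have p'n0 : p' != 0.
  by apply: contraTneq sge => ->; rewrite size_poly0 -ltnNge; exact: ltnW.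
have s1 : (size p1 < m)%N.
  apply: leq_trans (_ : size p' <= m)%N; last by rewrite -ltnS.
  have sp'0 : (0 < size p')%N by rewrite size_poly_gt0.
  rewrite -(prednK sp'0) ltnS; apply/leq_sizeP => i li.
  rewrite /p1 coefB coefCM -mulrA coefCM coefXnM.
  have di : (i < d)%N = false.
    apply/negbTE; rewrite -leqNgt (leq_trans _ li) // /d.
    by rewrite -subn1 leq_sub2l // sp ltnW.
  rewrite di; move: li; rewrite leq_eqVlt => /predU1P[<-|li].
    have -> : ((size p').-1 - d)%N = (size p).-1.
      rewrite /d -!subn1 subnAC subKn ?sp //.
    by rewrite -!lead_coefE mulrC subrr.
  have li' : (size p' <= i)%N by rewrite -(prednK sp'0).
  rewrite (nth_default _ li') (@nth_default _ 0 p) ?mulr0 ?subrr //.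
  rewrite leq_subRL; first by rewrite subnK ?sp.
  by rewrite leqNgt di.
have p1z : p1.[z] = 0 by rewrite /p1 !hornerE p'z pz !mulr0 subrr.
(* As [p], [p'] and the jet of [p] vanish at [z], the jet of [p1] is [a] times that of [p']. *)
have := IH _ _ s1 h1 p1z.
rewrite /p1 /q1 jetB !jetM !(hornerE, hornerXn) p'z pz ep.
rewrite !mulr0 !add0r subr0 => /eqP.
by rewrite mulf_eq0 (negPf an0) => /eqP.
Qed.

End Graph.

(** By Zorn's lemma there is a maximal derivation graph above [G]; it is total, since any further
    element could be adjoined. *)
Lemma derivation_graph_extend G : derivation_graph G ->
  exists D, derivation D /\ forall a a', G (a, a') -> D a = a'.
Proof.
(* The order is on the sets added to [G], so that the empty union, coming from the empty chain, also
   satisfies [P]. *)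
move=> hG; pose P (X : set (F * F)) := derivation_graph (G `|` X).
have [A [PA maxA]] : exists A, P A /\ forall B, A `<` B -> ~ P B.
  apply: Zorn_bigcup => H HP Htot.
  have PG X Y : (X = set0 \/ H X) -> (Y = set0 \/ H Y) ->
      exists Z, [/\ Z = set0 \/ H Z, X `<=` Z & Y `<=` Z].
    move=> [->|HX] [->|HY].
    - by exists set0; split => //; left.
    - by exists Y; split => //; right.
    - by exists X; split => //; right.
    - have [h|h] := Htot _ _ HX HY.
        by exists Y; split => //; right.
      by exists X; split => //; right.
  have Pd Z : (Z = set0 \/ H Z) -> P Z.
    by case=> [->|/HP//]; rewrite /P setU0.
  have sub Z : (Z = set0 \/ H Z) -> G `|` Z `<=` G `|` \bigcup_(X in H) X.
    by case=> [->|HZ]; [rewrite setU0; exact: subsetUl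
      | apply: setUS; exact: bigcup_sup].
  have wit c : (G `|` \bigcup_(X in H) X) c ->
      exists Z, (Z = set0 \/ H Z) /\ (G `|` Z) c.
    case=> [Gc|[X HX Xc]]; first by exists set0; split; left.
    by exists X; split; right.
  have wit2 c d : (G `|` \bigcup_(X in H) X) c -> (G `|` \bigcup_(X in H) X) d ->
      exists Z, [/\ Z = set0 \/ H Z, (G `|` Z) c & (G `|` Z) d].
    move=> /wit[X [hX Xc]] /wit[Y [hY Yd]]; have [Z [hZ XZ YZ]] := PG _ _ hX hY.
    by exists Z; split => //; [exact: setUS XZ _ Xc | exact: setUS YZ _ Yd].
  split; first by left; case: hG.
  - move=> a b a' b' h /(wit2 _ _ h)[Z [hZ Za Zb]].
    by apply: (sub Z hZ); case: (Pd _ hZ) => _ + _ _; exact.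
  - move=> a b a' b' h /(wit2 _ _ h)[Z [hZ Za Zb]].
    by apply: (sub Z hZ); case: (Pd _ hZ) => _ _ + _; exact.
  - by move=> w /wit[Z [hZ Zw]]; case: (Pd _ hZ) => _ _ _; exact.
have total z : exists w, (G `|` A) (z, w).
  have [w hw] := adjoin_derivation_graph PA z.
  have sGA := @graph_sub_adjoin _ PA z w.
  exists w; right; apply: contrapT => nA; apply: (maxA (adjoin_graph (G `|` A) z w)).
    split; last by move=> e; apply: nA; apply: e; exact: mem_adjoin_graph.
    by apply: subset_trans sGA; exact: subsetUr.
  by rewrite /P setUidr //; apply: subset_trans sGA; exact: subsetUl.
pose D z := projT1 (cid (total z)).
have DP z : (G `|` A) (z, D z) by exact: projT2 (cid (total z)).
case: PA => _ hB hM h0.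
have uniq z w : (G `|` A) (z, w) -> D z = w.
  move=> h; have := hB _ _ _ _ (DP z) h; rewrite subrr => /h0/eqP.
  by rewrite subr_eq0 => /eqP.
exists D; split; last by move=> a a' h; apply: uniq; left.
by split=> x y; apply: uniq; [exact: hB | exact: hM].
Qed.

End Derivations.

(** * Derivations of the reals and algebraic independence *)

Section DerivationTheory.
Variables (F : numFieldType) (D : F -> F).
Hypothesis hD : derivation D.

Lemma derivation0 : D 0 = 0.
Proof. by have [hB _] := hD; have := hB 0 0; rewrite !subrr. Qed.

Lemma derivationD x y : D (x + y) = D x + D y.
Proof.
have [hB _] := hD; have hN z : D (- z) = - D z.
  by rewrite -sub0r hB derivation0 sub0r.
by rewrite -[y in LHS]opprK hB hN opprK.
Qed.

Lemma derivation_sum (I : Type) (r : seq I) (P : pred I) (f : I -> F) :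
  D (\sum_(i <- r | P i) f i) = \sum_(i <- r | P i) D (f i).
Proof. exact: (big_morph D derivationD derivation0). Qed.

Lemma derivation_mulmx m n p (A : 'M[F]_(m, n)) (B : 'M[F]_(n, p)) :
  map_mx D (A *m B) = map_mx D A *m B + A *m map_mx D B.
Proof.
apply/matrixP => i j; rewrite !mxE derivation_sum -big_split.
by apply: eq_bigr => l _; have [_ ->] := hD; rewrite !mxE.
Qed.

Lemma derivation_sum_const m n (I : finType) (t : I -> F) (B : I -> 'M[F]_(m, n)) :
  (forall l i j, D (B l i j) = 0) ->
  map_mx D (\sum_l t l *: B l) = \sum_l D (t l) *: B l.
Proof.
move=> hB; apply/matrixP => i j; rewrite !(mxE, summxE) derivation_sum.
by apply: eq_bigr => l _; have [_ hM] := hD; rewrite !mxE hM hB mulr0 addr0.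
Qed.

End DerivationTheory.

Lemma derivation_comb (F : numFieldType) (I : finType) (a : I -> F)
    (D : I -> F -> F) : (forall i, derivation (D i)) ->
  derivation (fun x => \sum_i a i * D i x).
Proof.
move=> hD; split=> x y.
  by rewrite -sumrB; apply: eq_bigr => i _; have [-> _] := hD i; rewrite mulrBr.
rewrite mulr_suml mulr_sumr -big_split; apply: eq_bigr => i _ /=.
by have [_ ->] := hD i; ring.
Qed.

(** Independence makes evaluation at [x] injective on rational polynomials, so the sum of the [w i]
    times the partial derivatives is a well-defined derivation on the ring generated by [x]; it then
    extends to [R]. *)
Lemma alg_independent_derivation (R : realType) m (x w : 'I_m -> R) :
  alg_independent x -> exists D, derivation D /\ forall i, D (x i) = w i.
Proof.
move=> hx; pose ev (q : mpoly m rat) := meval x (map_mpoly (@ratr R) q).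
have evB p q : ev (p - q) = ev p - ev q by rewrite /ev !raddfB.
have evD p q : ev (p + q) = ev p + ev q by rewrite /ev !raddfD.
have evM p q : ev (p * q) = ev p * ev q by rewrite /ev !rmorphM.
pose G := [set c | exists q, c = (ev q, \sum_i w i * ev (mderiv i q))].
have hG : derivation_graph G.
  split.
  - exists 1; rewrite /ev !rmorph1; congr pair; rewrite big1 // => i _.
    by rewrite -mpolyC1 mderivC !raddf0 mulr0.
  - move=> _ _ _ _ [p [-> ->]] [q [-> ->]]; exists (p - q).
    rewrite evB -sumrB; congr pair; apply: eq_bigr => i _.
    by rewrite mderivB evB mulrBr.
  - move=> _ _ _ _ [p [-> ->]] [q [-> ->]]; exists (p * q).
    congr pair; first by rewrite evM.
    rewrite mulr_suml mulr_sumr -big_split.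
    by apply: eq_bigr => i _ /=; rewrite mderivM evD !evM; ring.
  - move=> z [q [/esym/hx -> ->]]; rewrite big1 // => i _.
    by rewrite mderiv0 /ev !raddf0 mulr0.
have [D [hD DG]] := derivation_graph_extend hG; exists D; split => // i.
apply: DG; exists (mpolyX _ (mnm1 i)); congr pair.
  by rewrite /ev map_mpolyX mevalXU.
rewrite (bigD1 i) //= mderivX mnm1E eqxx /= scale1r.
have -> : mnm_sub (mnm1 i) (mnm1 i) = mnm0 by apply/mnmP => j; rewrite !mnmE subnn.
rewrite mpolyX0.
rewrite /ev !rmorph1 mulr1 big1 ?addr0 // => j ji.
by rewrite mderivX mnm1E eq_sym (negPf ji) scale0r !raddf0 mulr0.
Qed.

(** Take derivations [D i] dual to [x]. The matrix of the [D i (y t)] has more rows than columns,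
    and a nonzero vector [a] of its left kernel gives the derivation, whose value at [x i] is
    [a 0 i]. *)
Lemma derivation_kills (R : realType) m (x : 'I_m -> R) (T : finType) (y : T -> R) :
  alg_independent x -> (#|T| < m)%N ->
  exists D, [/\ derivation D, forall t, D (y t) = 0 & exists i, D (x i) != 0].
Proof.
move=> hx Tm.
have /choice[D hD] : forall i : 'I_m, exists D : R -> R,
    derivation D /\ forall j, D (x j) = (i == j)%:R.
  by move=> i; exact: alg_independent_derivation.
pose M : 'M[R]_(m, #|T|) := \matrix_(i, j) D i (y (enum_val j)).
have : kermx M != 0.
  rewrite -mxrank_eq0 mxrank_ker subn_eq0 -ltnNge.
  exact: leq_ltn_trans (rank_leq_col _) Tm.
case/rowV0Pn => a /sub_kermxP aM an0.
exists (fun z => \sum_i a 0 i * D i z); split.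
- by apply: derivation_comb => i; case: (hD i).
- move=> t; have /matrixP/(_ 0 (enum_rank t)) := aM; rewrite !mxE => e.
  rewrite -[RHS]e.
  by apply: eq_bigr => i _; rewrite !mxE enum_rankK.
- have [i ai] : exists i, a 0 i != 0.
    apply/existsP; apply: contraNT an0; rewrite negb_exists => /forallP a0.
    by apply/eqP/rowP => i; rewrite mxE; apply/eqP; have := a0 i; rewrite negbK.
  exists i; rewrite (bigD1 i) //= (hD i).2 eqxx mulr1 big1 ?addr0 // => j ji.
  by rewrite (hD j).2 (negPf ji) mulr0.
Qed.

(** * Linear inequalities and vertices of polytopes *)

Lemma dotmul_ge0 (F : realDomainType) n (u : 'rV[F]_n) : 0 <= (u *m u^T) 0 0.
Proof. by rewrite mxE sumr_ge0 // => i _; rewrite mxE -expr2 sqr_ge0. Qed.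

Lemma dotmul_gt0 (F : realDomainType) n (u : 'rV[F]_n) :
  u != 0 -> 0 < (u *m u^T) 0 0.
Proof.
case/rV0Pn => i ui; rewrite lt_def dotmul_ge0 andbT mxE; apply: contraNneq ui.
move=> /eqP; rewrite psumr_eq0; last by move=> l _; rewrite mxE -expr2 sqr_ge0.
by move=> /allP/(_ i (mem_index_enum _)); rewrite mxE mulf_eq0 orbb.
Qed.

(** Finitely many strict inequalities survive a small perturbation; this serves to adjust linear
    functionals. *)
Lemma small_factor (F : realFieldType) (I : eqType) (s : seq I) (h k : I -> F) :
  {in s, forall i, 0 < h i} ->
  exists2 e, 0 < e & {in s, forall i, e * k i < h i}.
Proof.
elim: s => [|j s IH] hs; first by exists 1.
have [|e e0 es] := IH; first by move=> i si; apply: hs; rewrite inE si orbT.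
have hj : 0 < h j by apply: hs; rewrite inE eqxx.
have k0 : 0 < 1 + `|k j| by rewrite ltr_pwDl.
pose e' := Num.min e (h j / (1 + `|k j|)).
have e'0 : 0 < e' by rewrite lt_min e0 divr_gt0.
exists e' => // i; rewrite inE => /predU1P[->|si].
  apply: le_lt_trans (ler_wpM2l (ltW e'0) (ler_norm _)) _.
  rewrite -(divfK (lt0r_neq0 k0) (h j)).
  apply: le_lt_trans (_ : h j / (1 + `|k j|) * `|k j| < _).
    by rewrite ler_wpM2r // ge_min lexx orbT.
  by rewrite ltr_pM2l ?divr_gt0 // ltrDr.
have [ki|ki] := leP (k i) 0.
  by rewrite (le_lt_trans (mulr_ge0_le0 (ltW e'0) ki)) // hs // inE si orbT.
apply: le_lt_trans (es _ si); rewrite ler_wpM2r ?(ltW ki) //.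
by rewrite ge_min lexx.
Qed.

(* Induction on the number of vectors: if a functional c is positive on all
   but the first vector g j, the remaining vectors are combined with g j so as
   to be annihilated by c, and a second functional is obtained for them. *)
Lemma gordan (F : realFieldType) n (I : eqType) (s : seq I) (g : I -> 'rV[F]_n) :
  uniq s ->
  (forall a : I -> F, (forall i, 0 <= a i) -> \sum_(i <- s) a i *: g i = 0 ->
     {in s, forall i, a i = 0}) ->
  exists c : 'cV[F]_n, {in s, forall i, 0 < (g i *m c) 0 0}.
Proof.
elim: s g => [|j s IH] g; first by exists 0.
move=> /= /andP[js us] hg.
have extend (a : I -> F) b : (forall i, 0 <= a i) -> 0 <= b ->
    b *: g j + \sum_(i <- s) a i *: g i = 0 ->
    b = 0 /\ {in s, forall i, a i = 0}.
  move=> a0 b0 ab; pose a' i := if i == j then b else a i.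
  have a'0 i : 0 <= a' i by rewrite /a'; case: eqP.
  have a's : {in s, forall i, a' i = a i}.
    by move=> i si; rewrite /a'; case: eqP => // ij; rewrite -ij si in js.
  have za' : \sum_(i <- j :: s) a' i *: g i = 0.
    rewrite big_cons {1}/a' eqxx -[RHS]ab; congr (_ + _).
    by apply: eq_big_seq => i si; rewrite a's.
  have za := hg _ a'0 za'; split.
    by have := za j; rewrite inE eqxx /a' eqxx; exact.
  by move=> i si; rewrite -a's // za // inE si orbT.
have [|c hc] := IH g us.
  move=> a a0 za; have [] // := extend a 0 a0 (lexx _).
  by rewrite scale0r add0r.
pose r := - (g j *m c) 0 0.
have [r0|r0] := ltP r 0.
  exists c => i; rewrite inE => /predU1P[->|/hc//].
  by rewrite -oppr_lt0.
(* Both coefficients are nonnegative, and [c] vanishes on [g' i] because its value on [g j] is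
   [- r]. *)
pose g' i := r *: g i + (g i *m c) 0 0 *: g j.
have [|c' hc'] := IH g' us.
  move=> a a0 za.
  have [] // := extend (fun i => r * a i * (i \in s)%:R)
    (\sum_(i <- s) a i * (g i *m c) 0 0).
  - by move=> i; rewrite !mulr_ge0.
  - rewrite big_seq; apply: sumr_ge0 => i si.
    by rewrite mulr_ge0 // ltW // hc.
  - rewrite -[RHS]za addrC scaler_suml -big_split /=.
    apply: eq_big_seq => i si; rewrite si mulr1 /g' scalerDr !scalerA.
    by rewrite [r * _]mulrC.
  - move=> + _ i si; rewrite big_seq => /eqP; rewrite psumr_eq0; last first.
      by move=> l sl; rewrite mulr_ge0 // ltW // hc.
    move=> /allP/(_ i si); rewrite si /= mulf_eq0 (gt_eqF (hc _ si)) orbF.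
    by move/eqP.
have hc'E i : (g' i *m c') 0 0 = r * (g i *m c') 0 0 + (g i *m c) 0 0 * (g j *m c') 0 0.
  by rewrite mulmxDl -!scalemxAl !mxE.
(* If [r = 0], then [c] vanishes on [g j] while [c'] is positive there, provided [s] is nonempty: a
   small multiple of [c'] corrects [c]. For empty [s], the transpose of [g j] itself is a
   solution. *)
have [r_eq0|rn0] := eqVneq r 0.
  have [[i0 si0]|s0] := pselect (exists i, i \in s).
    have gj0 : 0 < (g j *m c') 0 0.
      have := hc' _ si0; rewrite hc'E r_eq0 mul0r add0r.
      by rewrite pmulr_rgt0 // hc.
    have [e e0 es] := small_factor (fun i => - (g i *m c') 0 0) hc.
    exists (c + e *: c') => i; rewrite mulmxDr -scalemxAr mxE [X in _ + X]mxE.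
    rewrite inE => /predU1P[->|si].
      by move/eqP: r_eq0; rewrite oppr_eq0 => /eqP ->; rewrite add0r mulr_gt0.
    by have := es _ si; rewrite mulrN -subr_gt0 opprK.
  exists (g j)^T => i; rewrite inE => /predU1P[->|si]; last by case: s0; exists i.
  have gjn0 : g j != 0.
    apply/eqP => gj0; have [] := extend (fun=> 0) 1 => //.
      rewrite gj0 scaler0 add0r big1 // => l _; exact: scale0r.
    by move/eqP; rewrite oner_eq0.
  exact: dotmul_gt0.
have rp : 0 < r by rewrite lt_def rn0 r0.
have h0 : {in s, forall i, 0 < (g' i *m c') 0 0 / r} by move=> i si; rewrite divr_gt0 ?hc'.
have [e e0 es] := small_factor (fun i => (g i *m c) 0 0) h0.
(* With this [t], the functional [c' + t *: c] takes the value [e * r] on [g j], and on [g i] the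
   value of [c'] on [g' i] divided by [r], minus [e] times the value of [c] on [g i]. *)
pose t := (g j *m c') 0 0 / r - e.
exists (c' + t *: c) => i; rewrite mulmxDr -scalemxAr mxE [X in _ + X]mxE.
rewrite inE => /predU1P[->|si].
  have -> : (g j *m c) 0 0 = - r by rewrite opprK.
  have -> : (g j *m c') 0 0 + t * - r = e * r.
    by rewrite /t; field.
  exact: mulr_gt0.
have := es _ si; rewrite hc'E mulrDl [r * _]mulrC mulfK //.
rewrite [_ * (g j *m c') 0 0]mulrC mulrAC -subr_gt0 => h.
by rewrite /t mulrBl addrA.
Qed.

(** Extremality of [p] rules out nontrivial nonnegative relations among the [p - q i] with [q i]
    distinct from [p], so [gordan] gives a functional whose only maximizer on [P] is [p]. The
    strictness leaves room to perturb it when it vanishes on [w]. *)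
Lemma vertex_functional (R : realType) n (P : set 'rV[R]_n) (p w : 'rV[R]_n) :
  polytope P -> vertices P p -> w != 0 ->
  exists c : 'cV[R]_n, (forall x, P x -> ((x - p) *m c) 0 0 <= 0) /\
    (w *m c) 0 0 != 0.
Proof.
move=> [m [q ->]] [Pp extp] wn0.
pose s := [seq i <- enum 'I_m | q i != p].
have sE i : (i \in s) = (q i != p) by rewrite mem_filter mem_enum andbT.
have [c hc] : exists c : 'cV[R]_n, {in s, forall i, 0 < ((p - q i) *m c) 0 0}.
  apply: gordan; first by rewrite filter_uniq // enum_uniq.
  move=> a a0 za j js; apply: contrapT => /eqP aj.
  have {aj} aj : 0 < a j by rewrite lt_def aj a0.
  pose a' i := a i * (q i != p)%:R; pose A := \sum_i a' i.
  have a'0 i : 0 <= a' i by rewrite mulr_ge0.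
  have a'j : a' j = a j by rewrite /a' -sE js mulr1.
  have A0 : 0 < A.
    rewrite /A (bigD1 j) //= a'j; apply: ltr_pwDl => //.
    by apply: sumr_ge0 => i _; exact: a'0.
  have ApE : \sum_i a' i *: q i = A *: p.
    apply/esym/eqP; rewrite -subr_eq0 scaler_suml -sumrB; apply/eqP.
    rewrite -[RHS]za big_filter big_enum_cond /= [RHS]big_mkcond /=.
    apply: eq_bigr => i _; rewrite /a' scalerBr.
    by case: ifP => _; rewrite ?mulr1 // mulr0 !scale0r subrr.
  have [al [al0 al1 pE]] := Pp.
  pose t := a j / (2 * A).
  have t0 : 0 < t by rewrite divr_gt0 // mulr_gt0.
  have ajA : a j <= A.
    by rewrite /A (bigD1 j) //= a'j lerDl; apply: sumr_ge0 => i _; exact: a'0.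
  have t1 : t < 1.
    by rewrite ltr_pdivrMr ?mulr_gt0 // mul1r; lra.
  have t1n0 : 1 - t != 0 by rewrite subr_eq0 gt_eqF.
  (* The average of two convex representations of [p], by [al] and by [a' / A], minus its guaranteed
     weight [t] at [q j]. Averaging keeps [t] at most 1/2, so the remaining weights can be
     normalized to give [y]. *)
  pose d i := al i / 2 + a' i / (2 * A) - t * (i == j)%:R.
  have sd (V : lmodType R) (x : 'I_m -> V) : \sum_i d i *: x i =
      2^-1 *: (\sum_i al i *: x i) + (2 * A)^-1 *: (\sum_i a' i *: x i) - t *: x j.
    have -> : t *: x j = \sum_i (t * (i == j)%:R) *: x i.
      rewrite (bigD1 j) //= eqxx mulr1 big1 ?addr0 // => i /negPf ->.
      by rewrite mulr0 scale0r.
    rewrite !scaler_sumr -big_split -sumrB; apply: eq_bigr => i _ /=.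
    by rewrite !scalerA /d scalerBl scalerDl [al i / 2]mulrC [a' i / _]mulrC.
  pose y := (1 - t)^-1 *: \sum_i d i *: q i.
  have Py : conv_hull q y.
    exists (fun i => (1 - t)^-1 * d i); split.
    - move=> i; rewrite mulr_ge0 //; first by rewrite invr_ge0 subr_ge0 ltW.
      rewrite /d; have [->|ij] := eqVneq i j.
        by rewrite a'j -/t mulr1 addrK divr_ge0.
      by rewrite mulr0 subr0 addr_ge0 // divr_ge0 // mulr_ge0 // ltW.
    - have := sd R^o (fun=> 1); rewrite -mulr_sumr.
      have E (f : 'I_m -> R) : \sum_i f i *: (1 : R^o) = \sum_i f i.
        by apply: eq_bigr => i _; rewrite /GRing.scale /= mulr1.
      rewrite !E => ->; rewrite al1 -/A /GRing.scale /= !mulr1.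
      by field; rewrite t1n0 gt_eqF.
    - by rewrite /y scaler_sumr; apply: eq_bigr => i _; rewrite scalerA.
  have Pq : conv_hull q (q j).
    exists (fun i => (i == j)%:R); split=> [i||]; first by rewrite ler0n.
      by rewrite (bigD1 j) //= eqxx big1 ?addr0 // => i /negPf ->.
    rewrite (bigD1 j) //= eqxx scale1r big1 ?addr0 // => i /negPf ->.
    by rewrite scale0r.
  have pyq : p = (1 - t) *: y + t *: q j.
    rewrite /y scalerA mulfV // scale1r sd subrK -pE ApE scalerA -scalerDl.
    rewrite -[LHS]scale1r; congr (_ *: _).
    by field; rewrite gt_eqF.
  have t01 : 0 < t < 1 by rewrite t0 t1.
  have [_ qp] := extp _ _ _ Py Pq t01 pyq.
  by move: js; rewrite sE qp eqxx.
have key (c' : 'cV[R]_n) : {in s, forall i, 0 < ((p - q i) *m c') 0 0} ->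
    forall x, conv_hull q x -> ((x - p) *m c') 0 0 <= 0.
  move=> hc' x [a [a0 a1 ->]].
  rewrite -[X in _ - X]scale1r -a1 scaler_suml -sumrB mulmx_suml summxE.
  apply: sumr_le0 => i _; rewrite -scalerBr -scalemxAl mxE.
  rewrite mulr_ge0_le0 // -opprB mulNmx mxE oppr_le0.
  have [->|qip] := eqVneq (q i) p; first by rewrite subrr mul0mx mxE.
  by rewrite ltW // hc' // sE.
have [wc|wc] := eqVneq ((w *m c) 0 0) 0; last by exists c; split => //; exact: key.
(* Adding [e *: w^T] changes the value on [w] from 0 to [e] times the squared norm of [w]. *)
have [e e0 es] := small_factor (fun i => - ((p - q i) *m w^T) 0 0) hc.
exists (c + e *: w^T); split.
  apply: key => i si; rewrite mulmxDr -scalemxAr mxE [X in _ + X]mxE.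
  by have := es _ si; rewrite mulrN -subr_gt0 opprK.
rewrite mulmxDr -scalemxAr mxE [X in _ + X]mxE wc add0r.
by rewrite mulf_neq0 // gt_eqF // dotmul_gt0.
Qed.

(* The curve is tangent to w at the vertex p for s = 0, and runs on both sides
   of s = 0: near a vertex this leaves P unless w = 0. *)
Lemma vertex_curve (R : realType) n (P : set 'rV[R]_n) (p w z : 'rV[R]_n) (a : R) :
  polytope P -> vertices P p -> P z -> 0 <= a ->
  (forall s, P ((1 + s ^+ 2 * a)^-1 *: (p + s *: w + (s ^+ 2 * a) *: z))) ->
  w = 0.
Proof.
move=> hP vp Pz a0 hs; apply: contrapT => /eqP wn0.
have [c [hc wc]] := vertex_functional hP vp wn0.
pose o := (w *m c) 0 0; pose b := ((z - p) *m c) 0 0.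
have b0 : b <= 0 := hc _ Pz.
have ineq s : s * o + s ^+ 2 * a * b <= 0.
  have s1 : 0 < 1 + s ^+ 2 * a by rewrite ltr_pwDl // mulr_ge0 // sqr_ge0.
  have := hc _ (hs s).
  have -> : (1 + s ^+ 2 * a)^-1 *: (p + s *: w + (s ^+ 2 * a) *: z) - p =
      (1 + s ^+ 2 * a)^-1 *: (s *: w + (s ^+ 2 * a) *: (z - p)).
    apply: (scalerI (lt0r_neq0 s1)); rewrite scalerBr !scalerA mulfV ?lt0r_neq0 //.
    by apply/rowP => i; rewrite !mxE; ring.
  rewrite -scalemxAl mxE pmulr_rle0 ?invr_gt0 // mulmxDl -!scalemxAl mxE.
  by rewrite [X in X + _]mxE [X in _ + X]mxE.
have ab0 : a * b <= 0 by exact: mulr_ge0_le0.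
have d0 : 0 < 1 - a * b by lra.
(* This [s] solves [s * o + s ^+ 2 * a * b = s ^+ 2], and it is nonzero since [o] is. *)
have := ineq (o / (1 - a * b)).
have -> : o / (1 - a * b) * o + (o / (1 - a * b)) ^+ 2 * a * b =
    (o / (1 - a * b)) ^+ 2 by field; rewrite gt_eqF.
apply/negP; rewrite -ltNge lt_def sqr_ge0 andbT sqrf_eq0 mulf_neq0 //.
by rewrite invr_eq0 gt_eqF.
Qed.

(** * Positive semidefinite matrices *)

Section PsdMatrices.
Variable R : realType.

Lemma psd_mxD k (A B : 'M[R]_k) : psd_mx A -> psd_mx B -> psd_mx (A + B).
Proof.
move=> [At hA] [Bt hB]; split; first by rewrite linearD /= At Bt.
by move=> u; rewrite mulmxDr mulmxDl mxE addr_ge0.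
Qed.

Lemma psd_mxZ k a (A : 'M[R]_k) : 0 <= a -> psd_mx A -> psd_mx (a *: A).
Proof.
move=> a0 [At hA]; split; first by rewrite linearZ /= At.
by move=> u; rewrite -scalemxAr -scalemxAl mxE mulr_ge0.
Qed.

Lemma psd_mx_congr m k (L : 'M[R]_(m, k)) (A : 'M[R]_k) :
  psd_mx A -> psd_mx (L *m A *m L^T).
Proof.
move=> [At hA]; split; first by rewrite !trmx_mul trmxK At mulmxA.
by move=> u; have := hA (u *m L); rewrite trmx_mul !mulmxA.
Qed.

Lemma psd_mx_gram m k (Y : 'M[R]_(k, m)) : psd_mx (Y *m Y^T).
Proof.
split; first by rewrite trmx_mul trmxK.
by move=> u; have := dotmul_ge0 (u *m Y); rewrite trmx_mul !mulmxA.
Qed.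

Lemma gram_mx_eq0 m k (M : 'M[R]_(m, k)) : M *m M^T = 0 -> M = 0.
Proof.
move=> M0; apply/row_matrixP => i; rewrite row0; apply/eqP/contraT => /dotmul_gt0.
have -> : (row i M *m (row i M)^T) 0 0 = (M *m M^T) i i.
  by rewrite !mxE; apply: eq_bigr => j _; rewrite !mxE.
by rewrite M0 mxE ltxx.
Qed.

Lemma psd_mx_diag0 k (A : 'M[R]_k) i j : psd_mx A -> A i i = 0 -> A i j = 0.
Proof.
move=> [At hA] Aii; apply/eqP/contraT => Aij.
have Aji : A j i = A i j by rewrite -{1}At mxE.
(* As [A i i = 0], the quadratic form at [u] is affine in [s]; this [s] makes it equal to -1. *)
pose s := - (A j j + 1) / (2 * A i j).
pose u : 'rV[R]_k := s *: delta_mx 0 i + delta_mx 0 j.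
have := hA u.
have -> : (u *m A *m u^T) 0 0 = s * (s * A i i + A j i) + (s * A i j + A j j).
  rewrite /u mulmxDl -scalemxAl -!rowE linearD linearZ /= !trmx_delta.
  by rewrite mulmxDr -scalemxAr -!colE !mxE.
rewrite Aii Aji mulr0 add0r addrA.
have -> : s * A i j + s * A i j = - (A j j + 1) by rewrite /s; field.
by rewrite opprD addrAC addNr add0r oppr_ge0 ler10.
Qed.

(** Cholesky factorization, by induction on the size through the Schur complement [C'] of the first
    diagonal entry. *)
Lemma psd_mx_factor k (A : 'M[R]_k) : psd_mx A -> exists Y : 'M[R]_k, A = Y *m Y^T.
Proof.
elim: k A => [|k IH] A hA; first by exists 0; apply/matrixP => - [].
have [At _] := hA.
(* A zero pivot gives [be = 0], as the inverse of 0 is 0; then [b = 0] by [psd_mx_diag0], so that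
   [bE] covers both cases. *)
pose al := A 0 0; pose be := al^-1; pose ra := Num.sqrt al.
have al0 : 0 <= al.
  by have := hA.2 (delta_mx 0 0); rewrite -rowE trmx_delta -colE !mxE.
have ra2 : ra * ra = al by rewrite -expr2 sqr_sqrtr.
pose b : 'rV[R]_k := @ursubmx _ 1 k 1 k A.
pose C : 'M[R]_k := @drsubmx _ 1 k 1 k A.
have AE : A = block_mx al%:M b b^T C :> 'M_(1 + k).
  rewrite -[LHS](@submxK _ 1 k 1 k); congr block_mx.
  - rewrite [LHS]mx11_scalar !mxE; congr (A _ _)%:M; exact/val_inj.
  - by rewrite trmx_ursub At.
pose B : 'M[R]_(1 + k) := block_mx al%:M b b^T C.
have hB : psd_mx B by rewrite /B -AE.
have bE : (al * be) *: b = b.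
  have [al_eq0|aln0] := eqVneq al 0; last by rewrite mulfV // scale1r.
  apply/rowP => j; rewrite al_eq0 mul0r scale0r mxE !mxE.
  have -> : lshift k (0 : 'I_1) = 0 by exact/val_inj.
  by rewrite psd_mx_diag0.
pose C' := C - be *: (b^T *m b).
have hC' : psd_mx C'.
  pose E : 'M[R]_(k, 1 + k) := row_mx (- be *: b^T) 1%:M.
  have -> : C' = E *m B *m E^T.
    rewrite /B /E mul_row_block tr_row_mx mul_row_col trmx1 !mulmx1 !mul1mx.
    rewrite mul_mx_scalar scalerA mulrN scaleNr -linearZ /= bE addNr mul0mx add0r.
    by rewrite /C' -scalemxAl scaleNr addrC.
  exact: psd_mx_congr.
have [Y' Y'E] := IH _ hC'.
pose Y : 'M[R]_(1 + k) := block_mx ra%:M 0 ((be * ra) *: b^T) Y'.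
suff BE : B = Y *m Y^T by exists Y; exact: etrans AE BE.
rewrite /B /Y tr_block_mx mulmx_block !trmx0 !mul0mx !mulmx0 !addr0 tr_scalar_mx.
rewrite linearZ /= trmxK; congr block_mx.
- by rewrite -scalar_mxM ra2.
- by rewrite mul_scalar_mx scalerA mulrCA ra2 mulrC bE.
- by rewrite mul_mx_scalar scalerA mulrCA ra2 mulrC -linearZ /= bE.
- rewrite -Y'E /C' -scalemxAl -scalemxAr scalerA.
  have -> : be * ra * (be * ra) = be * (al * be) by rewrite -ra2; ring.
  by rewrite -[be * _ *: _]scalerA scalemxAr bE addrC subrK.
Qed.

Lemma psd_mx_scalar_sub k (G : 'M[R]_k) : G^T = G ->
  exists2 c, 0 <= c & psd_mx (c%:M - G).
Proof.
move=> Gt; pose c := \sum_i \sum_j `|G i j|.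
exists c; first by apply: sumr_ge0 => i _; apply: sumr_ge0 => j _.
split=> [|u]; first by rewrite linearB /= tr_scalar_mx Gt.
rewrite mulmxBr mulmxBl mul_mx_scalar -scalemxAl mxE [X in _ + X]mxE [X in X + _]mxE.
rewrite subr_ge0 [leLHS]mxE.
under eq_bigr do rewrite mxE mulr_suml.
rewrite exchange_big /= /c mulr_suml; apply: ler_sum => i _.
rewrite mulr_suml; apply: ler_sum => j _; rewrite [u^T _ _]mxE.
have sq l : u 0 l ^+ 2 <= (u *m u^T) 0 0.
  rewrite mxE (bigD1 l) //= mxE -expr2 lerDl; apply: sumr_ge0 => l' _.
  by rewrite mxE -expr2 sqr_ge0.
apply: le_trans (ler_norm _) _; rewrite !normrM [`|u 0 i| * _]mulrC -mulrA.
rewrite ler_wpM2l //.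
have := sq i; have := sq j; rewrite -[u 0 i ^+ 2]real_normK ?num_real //.
rewrite -[u 0 j ^+ 2]real_normK ?num_real //.
have := sqr_ge0 (`|u 0 i| - `|u 0 j|); nra.
Qed.

(** Writing [E = L *m F] reduces the claim, by congruence with [L], to bounding [F *m F^T] by a
    scalar matrix. *)
Lemma psd_mx_unit_dominates k (L E : 'M[R]_k) : L \in unitmx ->
  exists2 a, 0 <= a & psd_mx (a *: (L *m L^T) - E *m E^T).
Proof.
move=> Lu; have [F ->] : exists F, E = L *m F.
  by exists (invmx L *m E); rewrite mulKVmx.
have [|a a0 ha] := @psd_mx_scalar_sub _ (F *m F^T).
  by rewrite trmx_mul trmxK.
exists a => //; have := psd_mx_congr L ha.
rewrite mulmxBr mulmxBl mul_mx_scalar -scalemxAl.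
by rewrite trmx_mul !mulmxA.
Qed.

(** Dually, the kernel of [A + B] lies in that of [A]: on it the quadratic forms of [A] and [B] sum
    to 0, so the Gram factor of [A] vanishes. *)
Lemma psd_mx_submx_add k (A B : 'M[R]_k) : psd_mx A -> psd_mx B -> (A <= (A + B)%R)%MS.
Proof.
move=> /psd_mx_factor[Y ->] /psd_mx_factor[L ->].
rewrite submxE; set T := (_ + _)%R; have := mulmx_coker T.
move: (cokermx T) => K TK.
have : (row_mx (K^T *m Y) (K^T *m L)) *m (row_mx (K^T *m Y) (K^T *m L))^T = 0.
  rewrite tr_row_mx mul_row_col !trmx_mul !trmxK -!mulmxA -mulmxDr.
  by rewrite !mulmxA -mulmxDl -/T TK mulmx0.
move=> /gram_mx_eq0; rewrite -row_mx0 => /eq_row_mx[/(congr1 trmx) KY _].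
by rewrite -mulmxA; move: KY; rewrite trmx_mul trmxK trmx0 => ->; rewrite mulmx0.
Qed.

End PsdMatrices.

(** * Lifts of minimal size *)

Section MinimalLift.
Variables (R : realType) (n k : nat) (P : set 'rV[R]_n).
Variables (A0 : 'M[R]_k) (U : {vspace 'M[R]_k}) (f : {linear 'M[R]_k -> 'rV[R]_n}).
Hypothesis symA : affine_subspace A0 U `<=` @sym_mx R k.
Hypothesis PE : P = f @` (affine_subspace A0 U `&` @psd_mx R k).

Let S : set 'M[R]_k := affine_subspace A0 U `&` @psd_mx R k.

(** Take [Z] of maximal rank. The midpoint of [X] and [Z] stays in the slice and its row space
    contains both row spaces, hence equals that of [Z]. *)
Lemma exists_maximal_slice : S !=set0 ->
  exists2 Z, S Z & forall X, S X -> (X <= Z)%MS.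
Proof.
case=> X0 SX0.
have ex : exists r, `[< exists2 X, S X & \rank X = r >].
  by exists (\rank X0); apply/asboolP; exists X0.
have bd r : `[< exists2 X, S X & \rank X = r >] -> (r <= k)%N.
  by move=> /asboolP[X _ <-]; exact: rank_leq_row.
case: (ex_maxnP ex bd) => _ /asboolP[Z SZ <-] maxZ.
exists Z => // X SX; have [AX pX] := SX; have [AZ pZ] := SZ.
have h0 : (0 : R) <= 2^-1 by rewrite invr_ge0.
have ST : S (2^-1 *: (X + Z)).
  split; last by apply: psd_mxZ => //; exact: psd_mxD.
  rewrite /affine_subspace /=.
  have -> : 2^-1 *: (X + Z) - A0 = 2^-1 *: ((X - A0) + (Z - A0)).
    by apply/matrixP => i j; rewrite !mxE; field.
  by rewrite memvZ // memvD.
have ZT : (Z <= (X + Z)%R)%MS by rewrite addrC; exact: psd_mx_submx_add.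
have TZ : (\rank (X + Z)%R <= \rank Z)%N.
  suff /maxZ : `[< exists2 X', S X' & \rank X' = \rank (X + Z)%R >] by [].
  apply/asboolP; exists (2^-1 *: (X + Z)) => //.
  by rewrite mxrank_scale_nz // invr_eq0 pnatr_eq0.
apply: submx_trans (psd_mx_submx_add pX pZ) _.
by rewrite -(mxrank_leqif_sup ZT).2 eqn_leq TZ mxrankS.
Qed.

(* If no element of the slice is invertible, the slice lies in a proper face of
   the psd cone; that face is a smaller psd cone and yields a smaller lift. *)
Lemma minimal_lift_unit :
  (forall j, (0 < j)%N -> psd_lift P j -> (k <= j)%N) ->
  P `<=` [set 0] \/ exists2 Z, S Z & Z \in unitmx.
Proof.
move=> mink; have [S0|nS0] := pselect (S !=set0); last first.
  by left=> y; rewrite PE => -[X SX _]; case: nS0; exists X.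
have [Z SZ maxZ] := exists_maximal_slice S0.
(* Rank 0 is treated apart because a competing lift must have positive size; the slice is then
   reduced to 0. *)
have [r0|r0] := posnP (\rank Z).
  left=> y; rewrite PE => -[X /maxZ XZ <-] /=.
  have /eqP Z0 : Z == 0 by rewrite -mxrank_eq0 r0.
  by move: XZ; rewrite Z0 submx0 => /eqP ->; rewrite linear0.
right; exists Z => //; rewrite -row_free_unit /row_free eqn_leq rank_leq_row /=.
apply: mink => //.
have [W [G [WG XGW]]] : exists (W : 'M[R]_(\rank Z, k)) (G : 'M[R]_(k, \rank Z)),
    W *m G = 1%:M /\ forall X, S X -> X *m G *m W = X.
  exists (row_base Z), (pinvmx (row_base Z)); split.
    exact/mulmxVp/row_base_free.
  by move=> X /maxZ XZ; rewrite mulmxKpV // eq_row_base.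
(* The rows of [W] form a basis of the row space of [Z], so [Phi] parametrizes the symmetric
   matrices supported on that space, which include the whole slice. *)
pose Phi : {linear 'M[R]_(\rank Z) -> 'M[R]_k} := (mulmx W^T) \o (mulmxr W).
have PhiE X' : Phi X' = W^T *m X' *m W by rewrite /= mulmxA.
have PhiK X : S X -> Phi (G^T *m X *m G) = X.
  move=> SX; have Xt : X^T = X by apply: symA; case: SX.
  have -> : Phi (G^T *m X *m G) = W^T *m G^T *m (X *m G *m W).
    by rewrite PhiE !mulmxA.
  by rewrite XGW // -{1}Xt -mulmxA -!trmx_mul XGW.
exists (G^T *m Z *m G), (linfun Phi @^-1: U)%VS, (f \o Phi).
have inA X' : affine_subspace (G^T *m Z *m G) (linfun Phi @^-1: U)%VS X' <->
    affine_subspace A0 U (Phi X').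
  rewrite /affine_subspace /= -memv_preim lfunE linearB PhiK //.
  have [AZ _] := SZ; have -> : Phi X' - Z = (Phi X' - A0) - (Z - A0).
    by rewrite opprB addrA subrK.
  by rewrite rpredBr.
split.
  move=> X' /inA/symA; rewrite /sym_mx /= mulmxA !trmx_mul trmxK.
  rewrite mulmxA => e; have PhiV M : G^T *m (W^T *m M *m W) *m G = M.
    by rewrite !mulmxA -trmx_mul WG trmx1 mul1mx -mulmxA WG mulmx1.
  by rewrite -[LHS]PhiV e PhiV.
rewrite PE predeqE => x; split.
- move=> [X SX <-]; exists (G^T *m X *m G); last by rewrite -[in RHS](PhiK _ SX).
  split; first by apply/inA; rewrite PhiK //; case: SX.
  by rewrite -[G in _ *m G]trmxK; apply: psd_mx_congr; case: SX.
- move=> [X' [/inA AX pX] <-]; exists (Phi X') => //; split => //.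
  by rewrite PhiE -[W in _ *m W]trmxK; exact: psd_mx_congr.
Qed.

End MinimalLift.

(** * Dimension and parameter counts for a lift *)

Definition upper_index (k : nat) : finType :=
  {ij : 'I_k * 'I_k | (ij.1 <= ij.2)%N}.

Lemma card_upper_index k : (#|upper_index k| * 2 = k * k.+1)%N.
Proof.
pose A := [set ij : 'I_k * 'I_k | (ij.1 <= ij.2)%N]%SET.
pose B := [set ij : 'I_k * 'I_k | (ij.2 <= ij.1)%N]%SET.
have -> : #|upper_index k| = #|A| by rewrite card_sig cardsE.
have AB : #|A| = #|B|.
  pose sw (ij : 'I_k * 'I_k) := (ij.2, ij.1).
  have swK : involutive sw by case.
  have <- : sw @: A = B.
    by rewrite (can_imset_pre _ swK); apply/setP => ij; rewrite !inE.
  by rewrite (card_imset _ (inv_inj swK)).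
have AUB : A :|: B = [set: 'I_k * 'I_k]%SET.
  by apply/setP => ij; rewrite !inE leq_total.
have AIB : A :&: B = [set (i, i) | i : 'I_k]%SET.
  apply/setP => -[i j]; rewrite !inE -eqn_leq /=; apply/eqP/imsetP.
    by move=> /val_inj ->; exists j.
  by case=> l _ [-> ->].
rewrite muln2 -addnn {2}AB -cardsUI AUB AIB cardsT card_prod card_ord.
by rewrite card_imset ?card_ord ?mulnS 1?addnC // => i j [].
Qed.

Lemma symmetric_dim_le (R : realType) k (U : {vspace 'M[R]_k}) :
  (forall X, X \in U -> X^T = X) -> (\dim U <= #|upper_index k|)%N.
Proof.
move=> symU.
pose g (X : 'M[R]_k) : 'rV[R]_#|upper_index k| :=
  \row_t X (val (enum_val t)).1 (val (enum_val t)).2.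
have lg : linear g by move=> a X Y; apply/rowP => t; rewrite !mxE.
pose gl := GRing.isLinear.Build _ _ _ _ g lg.
pose G : {linear 'M[R]_k -> 'rV[R]_#|upper_index k|} := HB.pack g gl.
rewrite -(@limg_dim_eq _ _ _ (linfun G)); last first.
  apply/eqP; rewrite -subv0; apply/subvP => X; rewrite memv_cap memv_ker lfunE /=.
  move=> /andP[/symU Xt /eqP/rowP gX]; rewrite memv0; apply/eqP/matrixP => i j.
  wlog ij : i j / (i <= j)%N.
    move=> h; have [/h//|/ltnW/h e] := leqP i j.
    by rewrite -Xt !mxE e mxE.
  have := gX (enum_rank (exist _ (i, j) ij : upper_index k)).
  by rewrite !mxE enum_rankK.
apply: leq_trans (dimvS (subvf _)) _.
by rewrite dimvf; apply: eq_leq; exact: mul1n.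
Qed.

(** With [N] the number of upper indices, the left side is at most [N * (2 * N - 1)]. The strictness
    of the bound on [d] matters: for [k = 1] the two sides can agree, and for [k = 2] the estimate
    reads 15 <= 16. *)
Lemma parameter_count (n k d : nat) : (0 < k)%N -> (n <= d)%N ->
  (d < #|upper_index k|)%N ->
  (d.+1 * (#|upper_index k| + n) <= k ^ 4)%N.
Proof.
move=> k0 nd dN; have := card_upper_index k.
move: #|upper_index k| dN => N dN NE.
have h1 : (d.+1 * (N + n) <= N * (N + N.-1))%N.
  apply: leq_mul => //; rewrite leq_add2l (leq_trans nd) //.
  by rewrite -ltnS prednK // (leq_ltn_trans _ dN).
apply: leq_trans h1 _.
have N0 : (0 < N)%N by apply: leq_ltn_trans dN.
have {NE} NE : (N + N.-1).+1 = (k * k.+1)%N.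
  by rewrite -addnS prednK // -NE muln2 addnn.
have e : (N * 2 = (N + N.-1).+1)%N by rewrite -addnS prednK // muln2 addnn.
move: (N + N.-1)%N NE e => m mE e.
have [k1|k2] := leqP k 1.
  have kE : k = 1%N by apply/eqP; rewrite eqn_leq k1 k0.
  move: mE e; rewrite kE; nia.
case: k k2 {k0} mE => [|[|j]] // _ mE.
have {}mE : m = (j * j + 5 * j + 5)%N by nia.
rewrite -(leq_pmul2r (isT : (0 < 2)%N)) mulnAC e mE.
have -> : (j.+2 ^ 4 = j.+2 * j.+2 * j.+2 * j.+2)%N.
  by rewrite !expnS expn0 muln1 !mulnA.
nia.
Qed.

(** Since [P] spans the space affinely, every [y + f A0] is an affine combination of points [f X]
    with [X - A0] in [U]; hence [f] maps [U] onto the whole space. *)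
Lemma lift_dim_ge (R : realType) n k (P : set 'rV[R]_n) (A0 : 'M[R]_k)
    (U : {vspace 'M[R]_k}) (f : {linear 'M[R]_k -> 'rV[R]_n}) :
  has_dim P n -> P `<=` f @` affine_subspace A0 U -> (n <= \dim U)%N.
Proof.
move=> [x0 [U0 [hull dU0]]] PA.
have U0f : U0 = fullv.
  by apply/eqP; rewrite eqEdim subvf /= dU0 dimvf; apply: eq_leq; exact: mul1n.
have hullT x : affine_hull P x by rewrite hull U0f /affine_subspace /= memvf.
have imf : (fullv <= linfun f @: U)%VS.
  apply/subvP => y _; have [m [p [a [pP a1 yE]]]] := hullT (y + f A0).
  have -> : y = \sum_i a i *: (p i - f A0).
    under eq_bigr do rewrite scalerBr.
    by rewrite sumrB -yE -scaler_suml a1 scale1r addrK.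
  apply: memv_suml => i _; apply: memvZ.
  have [X AX <-] := PA _ (pP i).
  by rewrite -linearB -[f _](lfunE f) memv_img.
have := dimvS imf; rewrite dimvf [dim _]mul1n => /leq_trans; apply.
by rewrite -(limg_ker_dim (linfun f) U) leq_addl.
Qed.

(* Differentiating X = Y Y^T gives D X = E Y^T + Y E^T with E = D Y, so that
   X + s D X + s^2 E E^T = (Y + s E) (Y + s E)^T is psd for all s; a multiple of
   the interior point Z absorbs the second order term. *)
Lemma lift_vertex_derivation (R : realType) n k (P : set 'rV[R]_n)
    (A0 Z : 'M[R]_k) (U : {vspace 'M[R]_k}) (f : {linear 'M[R]_k -> 'rV[R]_n})
    (D : R -> R) (p : 'rV[R]_n) :
  polytope P -> P = f @` (affine_subspace A0 U `&` @psd_mx R k) ->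
  affine_subspace A0 U Z -> psd_mx Z -> Z \in unitmx ->
  derivation D ->
  (forall l : 'I_(\dim U).+1, map_mx D (A0 :: vbasis U)`_l = 0 /\
                              map_mx D (f (A0 :: vbasis U)`_l) = 0) ->
  vertices P p -> map_mx D p = 0.
Proof.
move=> polP PE AZ pZ Zu hD; set b := fun l => (A0 :: vbasis U)`_l => Db vp.
have [X [AX pX] fX] : (f @` (affine_subspace A0 U `&` @psd_mx R k)) p.
  by rewrite -PE; case: vp.
have Pf Y : affine_subspace A0 U Y -> psd_mx Y -> P (f Y).
  by move=> AY pY; rewrite PE; exists Y.
(* Coordinates of [X] along [A0] (index 0, coefficient 1) and along the basis of [U]. *)
pose t (l : 'I_(\dim U).+1) :=
  oapp (fun i => coord (vbasis U) i (X - A0)) 1 (unlift ord0 l).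
have XE : X = \sum_l t l *: b l.
  rewrite big_ord_recl {1}/t unlift_none scale1r -[LHS](subrK A0) addrC; congr (_ + _).
  rewrite [LHS](coord_vbasis AX); apply: eq_bigr => i _.
  by rewrite /t liftK.
have DX : map_mx D X = \sum_l D (t l) *: b l.
  rewrite XE derivation_sum_const // => l i j.
  by have /matrixP/(_ i j) := (Db l).1; rewrite !mxE.
(* [D] commutes with [f] here because it kills the images under [f] of [A0] and of the basis. *)
have Dp : map_mx D p = f (map_mx D X).
  rewrite DX -fX XE !linear_sum /=; under eq_bigr do rewrite linearZ.
  under [RHS]eq_bigr do rewrite linearZ.
  rewrite derivation_sum_const // => l i j.
  by have /matrixP/(_ i j) := (Db l).2; rewrite !mxE.
have D1 : D 1 = 0.
  have [_ /(_ 1 1)] := hD; rewrite !mulr1 mul1r => /eqP.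
  by rewrite -subr_eq0 opprD addrA subrr sub0r oppr_eq0 => /eqP.
(* The coefficient of [A0] is the constant 1, which [D] sends to 0. *)
have UDX : map_mx D X \in U.
  rewrite DX big_ord_recl /t unlift_none D1 scale0r add0r.
  apply: memv_suml => i _; apply: memvZ; apply: vbasis_mem; rewrite /b /=.
  by rewrite mem_nth ?size_tuple ?ltn_ord.
have [Y YE] := psd_mx_factor pX; have [L LE] := psd_mx_factor pZ.
have Lu : L \in unitmx by move: Zu; rewrite LE unitmx_mul => /andP[].
have [a a0 ha] := psd_mx_unit_dominates (map_mx D Y) Lu.
rewrite -LE in ha.
apply: (vertex_curve polP vp (Pf _ AZ pZ) a0) => s.
set c := s ^+ 2 * a; have c0 : 0 <= c by rewrite mulr_ge0 // sqr_ge0.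
have c1 : 1 + c != 0 by rewrite gt_eqF // ltr_pwDl.
rewrite Dp -fX -!linearZ -!linearD -linearZ /=; apply: Pf.
  rewrite /affine_subspace /=.
  have -> : (1 + c)^-1 *: (X + s *: map_mx D X + c *: Z) - A0 =
      (1 + c)^-1 *: ((X - A0) + s *: map_mx D X + c *: (Z - A0)).
    apply: (scalerI c1); rewrite scalerBr !scalerA mulfV // !scale1r.
    by apply/matrixP => i j; rewrite !mxE; ring.
  by apply: memvZ; apply: memvD; [apply: memvD => //; exact: memvZ | exact: memvZ].
apply: psd_mxZ; first by rewrite invr_ge0 addr_ge0.
have -> : X + s *: map_mx D X + c *: Z =
    (Y + s *: map_mx D Y) *m (Y + s *: map_mx D Y)^T +
    s ^+ 2 *: (a *: Z - map_mx D Y *m (map_mx D Y)^T).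
  have -> : (Y + s *: map_mx D Y)^T = Y^T + s *: (map_mx D Y)^T.
    by rewrite linearD linearZ.
  rewrite {1 2}YE derivation_mulmx // -map_trmx.
  rewrite mulmxDr !mulmxDl -!scalemxAr -!scalemxAl.
  by apply/matrixP => i j; rewrite /c !mxE; ring.
by apply: psd_mxD; [exact: psd_mx_gram | apply: psd_mxZ => //; exact: sqr_ge0].
Qed.

(** * The bound for generic polytopes *)

Lemma alg_independent_neq0 (R : realType) m (x : 'I_m -> R) i :
  alg_independent x -> x i != 0.
Proof.
move=> /(@alg_independent_derivation _ _ _ (fun=> 1))[D [hD Dx]].
by apply/eqP => xi; have := Dx i; rewrite xi derivation0 // => /eqP; rewrite eq_sym oner_eq0.
Qed.

Lemma generic_psd_lift_bound (R : realType) n v k (P : set 'rV[R]_n)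
    (V : 'M[R]_(v, n)) :
  polytope P -> has_dim P n -> (forall i, vertices P (row i V)) ->
  alg_independent (fun l => mxvec V 0 l) ->
  (0 < k)%N -> psd_lift P k ->
  (forall j, (0 < j)%N -> psd_lift P j -> (k <= j)%N) ->
  (v * n <= k ^ 4)%N.
Proof.
move=> polP dimP vV hV k0 [A0 [U [f [symA PE]]]] mink.
rewrite leqNgt; apply/negP => lt.
have Vn0 i j : V i j != 0.
  by have := alg_independent_neq0 (mxvec_index i j) hV; rewrite mxvecE.
have [i0 [j0 _]] : exists (i : 'I_v) (j : 'I_n), true.
  have : (0 < v * n)%N by exact: leq_ltn_trans lt.
  rewrite muln_gt0 => /andP[v0 n0].
  by exists (Ordinal v0), (Ordinal n0).
have rowVn0 i : row i V != 0.
  by apply/rV0Pn; exists j0; rewrite mxE.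
have [P0|[Z [AZ pZ] Zu]] := minimal_lift_unit symA PE mink.
  by have /eqP := P0 _ (vV i0).1; apply/negP.
have A0t : A0^T = A0 by apply: symA; rewrite /affine_subspace /= subrr mem0v.
have symU X : X \in U -> X^T = X.
  move=> UX; have : (X + A0)^T = X + A0 by apply: symA; rewrite /affine_subspace /= addrK.
  by rewrite linearD /= A0t => /addIr.
(* Otherwise the slice is a cone, whose linear image has no vertex but 0. *)
have A0U : A0 \notin U.
  apply/negP => A0U.
  have [X [AX pX] fX] :
      (f @` (affine_subspace A0 U `&` @psd_mx R k)) (row i0 V).
    by rewrite -PE; case: (vV i0).
  have Pc c : 0 <= c -> P (c *: row i0 V).
    move=> c0; rewrite PE -fX -linearZ; exists (c *: X) => //; split; last exact: psd_mxZ.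
    have UX : X \in U by rewrite -[X](subrK A0) memvD.
    by rewrite /affine_subspace /= memvB // memvZ.
  have [_ ext] := vV i0.
  have [] := ext _ _ (2^-1) (Pc 0 (lexx _)) (Pc 2 _).
  - by [].
  - by apply/andP; split; lra.
  - by rewrite scale0r scaler0 add0r scalerA mulVf // ?scale1r // pnatr_eq0.
  by rewrite scale0r => /esym/eqP; rewrite (negPf (rowVn0 i0)).
(* The span of [U] and [A0] still consists of symmetric matrices and has dimension one more than
   [U]. *)
have dU : (\dim U < #|upper_index k|)%N.
  have capU : (U :&: <[A0]> = 0)%VS.
    apply/eqP; rewrite -subv0; apply/subvP => X; rewrite memv_cap => /andP[UX /vlineP[c Xc]].
    rewrite memv0 Xc scaler_eq0; apply/orP; left; apply: contraNT A0U => cn0.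
    by rewrite -[A0](scalerK cn0) -Xc memvZ.
  have A0n0 : A0 != 0 by apply: contraNneq A0U => ->; exact: mem0v.
  have <- : \dim (U + <[A0]>) = (\dim U).+1.
    by rewrite dimv_disjoint_sum // dim_vline A0n0 addn1.
  apply: symmetric_dim_le => X /memv_addP[Y UY [_ /vlineP[c ->] ->]].
  by rewrite linearD linearZ /= A0t symU.
have nU : (n <= \dim U)%N.
  apply: lift_dim_ge dimP _; rewrite PE; apply: image_subset; exact: subIsetl.
pose b (l : 'I_(\dim U).+1) := (A0 :: vbasis U)`_l.
(* The parameters of the lift: by symmetry, upper entries suffice for [A0] and the basis of [U]. *)
pose y (t : 'I_(\dim U).+1 * (upper_index k + 'I_n)) : R :=
  match t.2 with
  | inl ij => b t.1 (val ij).1 (val ij).2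
  | inr j => f (b t.1) 0 j
  end.
have cT : (#|{: 'I_(\dim U).+1 * (upper_index k + 'I_n)}| < v * n)%N.
  rewrite card_prod card_sum !card_ord.
  exact: leq_ltn_trans (parameter_count k0 nU dU) lt.
have [D [hD Dy [l Dl]]] := derivation_kills y hV cT.
have bsym l' : (b l')^T = b l'.
  rewrite /b; case: (unliftP ord0 l') => [i ->|->] //=.
  by apply/symU/vbasis_mem; rewrite mem_nth ?size_tuple ?ltn_ord.
have Db l' : map_mx D (b l') = 0 /\ map_mx D (f (b l')) = 0.
  split; apply/matrixP => i j; rewrite !mxE.
    wlog ij : i j / (i <= j)%N.
      move=> h; have [/h//|/ltnW/h e] := leqP i j.
      by rewrite -bsym mxE.
    exact: (Dy (l', inl (exist _ (i, j) ij))).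
  by rewrite ord1; exact: (Dy (l', inr j)).
case/mxvec_indexP: l Dl => i j; rewrite mxvecE; apply/negP; rewrite negbK.
have /rowP/(_ j) := lift_vertex_derivation polP PE AZ pZ Zu hD Db (vV i).
by rewrite !mxE => ->.
Qed.

Theorem theorem2p1 (R : realType) (n v : nat) (P : set 'rV[R]_n)
    (hP : polytope P) (hdim : has_dim P n)
    (hv : (vertices P #= `I_v)%card) (hgen : generic P) :
  (n * v)%:R `^ (4%:R^-1) <= (psd_rank P)%:R :> R.
Proof.
have [v' [V [injV rangeV hV]]] := hgen.
(* Both count the vertices: the rows of [V] enumerate them injectively. *)
have vE : v' = v.
  apply/card_eq_II; apply: card_eq_trans hv; rewrite -rangeV.
  apply: card_eq_trans card_II _; rewrite card_eq_sym.
  by apply: inj_card_eq => i j _ _; exact: injV.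
(* The affine hull contains [x0], and an affine combination of no points is impossible; so
   [psd_rank] does not take its default value. *)
have P0 : P !=set0.
  have [x0 [U [hull _]]] := hdim.
  have : affine_hull P x0 by rewrite hull /affine_subspace /= subrr mem0v.
  case=> -[|m] [p [a [pP a1 _]]]; last by exists (p ord0).
  by move: a1; rewrite big_ord0 => /eqP; rewrite eq_sym oner_eq0.
have [k0 liftk mink] := psd_rankP hP P0.
have vV i : vertices P (row i V) by rewrite -rangeV; exists i.
have := generic_psd_lift_bound hP hdim vV hV k0 liftk mink.
rewrite vE mulnC => le.
have -> : (psd_rank P)%:R = ((psd_rank P)%:R ^+ 4) `^ (4%:R^-1) :> R.
  by rewrite -powR_mulrn // -powRrM mulfV ?pnatr_eq0 // powRr1.
apply: ge0_ler_powR; rewrite ?nnegrE ?invr_ge0 ?exprn_ge0 ?ler0n //.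
by rewrite -natrX ler_nat.
Qed.
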